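(* For a group $\Gamma\subset PGL_{2n+2}(\mathbb{C})$ of type $\mathcal{L}$, the limit set $\Lambda(\Gamma)$ is a closed, nowhere dense, $\Gamma$-invariant subset of $\mathbb{P}^{2n+1}$.
   Context: Fix $n\geq1$. An $n$-plane is an $n$-dimensional projective linear subspace of $\mathbb{P}^{2n+1}$; $|\ell|$ denotes its point set. Let $N=\binom{2n+2}{n+1}-1$, $\mathbb{P}^N=\mathbb{P}(\Lambda^{n+1}\mathbb{C}^{2n+2})$, and $\mathcal{G}\subset\mathbb{P}^N$ the Grassmannian $Gr(n+1,2n+2)$ embedded by Plücker coordinates; $\hat\ell\in\mathcal{G}$ is the point of an $n$-plane $\ell$. Each $\sigma\in PGL_{2n+2}(\mathbb{C})$ induces $\hat\sigma\in PGL_{N+1}(\mathbb{C})$ via $\Lambda^{n+1}$ of a representative. For a sequence $(\tau_\nu)$ of pairwise distinct elements of $PGL_{m+1}(\mathbb{C})$, pick representatives in $GL_{m+1}(\mathbb{C})$ whose largest entry in absolute value is $1$; if they can be chosen to converge to $T\in M_{m+1}(\mathbb{C})$, the limit image is $\mathbb{P}(\operatorname{Im}T)$. For a discrete $\Gamma\subset PGL_{2n+2}(\mathbb{C})$, a sequence $(\sigma_\nu)\subset\Gamma$ is normal if it consists of distinct elements and both $(\sigma_\nu)$ and $(\hat\sigma_\nu)$ admit such convergent normalized representatives. An $n$-plane $\ell$ is a limit $n$-plane of $\Gamma$ if $\hat\ell\in\mathcal{G}\cap I(\hat\sigma_\nu)$ for some normal sequence, $I(\hat\sigma_\nu)$ being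 the limit image of $(\hat\sigma_\nu)$. The limit set $\Lambda(\Gamma)$ is the union of $|\ell|$ over all limit $n$-planes $\ell$ of $\Gamma$, and $\Omega(\Gamma)=\mathbb{P}^{2n+1}\setminus\Lambda(\Gamma)$. A domain is large if it contains an $n$-plane; a discrete subgroup $\Gamma$ is of type $\mathcal{L}$ if $\Omega(\Gamma)$ contains a large domain. *)

(* Defs.v *)
From mathcomp Require Import all_boot all_algebra.
From mathcomp Require Import reals.
From mathcomp Require Export complex.
Export GRing.Theory Num.Theory.

Set Implicit Arguments.
Unset Strict Implicit.
Unset Printing Implicit Defensive.

Local Open Scope ring_scope.
Local Open Scope complex_scope.

Section Defs.
Variable R : realType.
Local Notation C := R[i].

Definition mx_near {p q} (A B : 'M[C]_(p, q)) (e : R) : Prop :=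
  forall i j, `|A i j - B i j| < e%:C.

Definition mx_cvg {p q} (A : nat -> 'M[C]_(p, q)) (T : 'M[C]_(p, q)) : Prop :=
  forall e : R, 0 < e -> exists N, forall nu, (N <= nu)%N -> mx_near (A nu) T e.

Definition normalized {p q} (A : 'M[C]_(p, q)) : Prop :=
  (forall i j, `|A i j| <= 1) /\ exists i j, `|A i j| = 1.

(* the projective classes of the A nu admit normalized representatives
   c nu *: A nu converging to T *)
Definition normalized_cvg {p} (A : nat -> 'M[C]_p) (T : 'M[C]_p) : Prop :=
  exists c : nat -> C, (forall nu, c nu != 0) /\
    (forall nu, normalized (c nu *: A nu)) /\
    mx_cvg (fun nu => c nu *: A nu) T.

(* a subset of P^(m-1) is encoded by its (scale invariant) preimage in C^m \ 0 *)
Definition proj_set {m} (A : 'cV[C]_m -> Prop) : Prop :=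
  forall v c, A v -> c != 0 -> v != 0 /\ A (c *: v).

(* open in the quotient topology: preimage open in C^m \ 0 *)
Definition popen {m} (U : 'cV[C]_m -> Prop) : Prop :=
  proj_set U /\
  forall v, U v -> exists e : R, 0 < e /\ forall w, w != 0 -> mx_near w v e -> U w.

Definition pclosed {m} (A : 'cV[C]_m -> Prop) : Prop :=
  proj_set A /\ popen (fun v => v != 0 /\ ~ A v).

Definition pclosure {m} (A : 'cV[C]_m -> Prop) (v : 'cV[C]_m) : Prop :=
  v != 0 /\ forall U, popen U -> U v -> exists w, U w /\ A w.

Definition pnowhere_dense {m} (A : 'cV[C]_m -> Prop) : Prop :=
  forall U, popen U -> (forall v, U v -> pclosure A v) -> forall v, ~ U v.

Definition pconnected {m} (D : 'cV[C]_m -> Prop) : Prop :=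
  forall U V, popen U -> popen V ->
    (forall v, D v -> U v \/ V v) ->
    (forall v, D v -> U v -> V v -> False) ->
    (exists v, D v /\ U v) -> (exists v, D v /\ V v) -> False.

Definition pdomain {m} (D : 'cV[C]_m -> Prop) : Prop :=
  popen D /\ pconnected D /\ exists v, D v.

(* an n-plane is P(Im B) for B of rank n+1 *)
Definition nplane {n} (B : 'M[C]_(n.*2.+2, n.+1)) : Prop := \rank B = n.+1.

Definition plane_pts {n} (B : 'M[C]_(n.*2.+2, n.+1)) (v : 'cV[C]_(n.*2.+2)) : Prop :=
  v != 0 /\ exists x, v = B *m x.

(* index set of Lambda^(n+1) C^(2n+2): the (n+1)-subsets of {0..2n+1} *)
Definition plidx (n : nat) := {S : {set 'I_(n.*2.+2)} | #|S| == n.+1}.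
Definition pldim (n : nat) : nat := #|{: plidx n}|.

Definition plset {n} (i : 'I_(pldim n)) : {set 'I_(n.*2.+2)} := val (enum_val i).

(* a-th element (in increasing order) of S *)
Definition rows_of {n} (S : {set 'I_(n.*2.+2)}) (a : nat) : 'I_(n.*2.+2) :=
  nth ord0 (enum S) a.

Definition plucker {n} (B : 'M[C]_(n.*2.+2, n.+1)) : 'cV[C]_(pldim n) :=
  \col_i \det (\matrix_(a < n.+1, b < n.+1) B (rows_of (plset i) a) b).

Definition ext_pow {n} (A : 'M[C]_(n.*2.+2)) : 'M[C]_(pldim n) :=
  \matrix_(i, j) \det (\matrix_(a < n.+1, b < n.+1)
                         A (rows_of (plset i) a) (rows_of (plset j) b)).

(* a subgroup of PGL_m is encoded by its preimage in GL_m (scale invariant) *)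
Definition pgl_subgroup {m} (G : 'M[C]_m -> Prop) : Prop :=
  (forall g, G g -> g \in unitmx) /\
  (forall g c, G g -> c != 0 -> G (c *: g)) /\
  G 1%:M /\
  (forall g h, G g -> G h -> G (g *m h)) /\
  (forall g, G g -> G (invmx g)).

Definition proportional {p q} (A B : 'M[C]_(p, q)) : Prop :=
  exists c : C, c != 0 /\ A = c *: B.

(* discreteness in PGL_m with its quotient topology: each [g] has a neighborhood
   { [h] | exists c <> 0, c h within e of g } meeting G only in [g] *)
Definition pgl_discrete {m} (G : 'M[C]_m -> Prop) : Prop :=
  forall g, G g -> exists e : R, 0 < e /\
    forall h, G h -> (exists c : C, c != 0 /\ mx_near (c *: h) g e) -> proportional h g.

Definition normal_seq {n} (G : 'M[C]_(n.*2.+2) -> Prop) (s : nat -> 'M[C]_(n.*2.+2)) : Prop :=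
  (forall nu, G (s nu)) /\
  (forall mu nu, mu <> nu -> ~ proportional (s mu) (s nu)) /\
  (exists T, normalized_cvg s T) /\
  (exists T, normalized_cvg (fun nu => ext_pow (s nu)) T).

(* l = P(Im B) is a limit n-plane: its Pluecker point lies in the limit image
   P(Im T) of (hat sigma_nu) for some normal sequence *)
Definition limit_plane {n} (G : 'M[C]_(n.*2.+2) -> Prop) (B : 'M[C]_(n.*2.+2, n.+1)) : Prop :=
  nplane B /\ exists s, normal_seq G s /\
    exists T, normalized_cvg (fun nu => ext_pow (s nu)) T /\
      exists x, T *m x = plucker B.

Definition limit_set {n} (G : 'M[C]_(n.*2.+2) -> Prop) (v : 'cV[C]_(n.*2.+2)) : Prop :=
  exists B, limit_plane G B /\ plane_pts B v.

Definition discontinuity_region {n} (G : 'M[C]_(n.*2.+2) -> Prop) (v : 'cV[C]_(n.*2.+2)) : Prop :=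
  v != 0 /\ ~ limit_set G v.

Definition large {n} (D : 'cV[C]_(n.*2.+2) -> Prop) : Prop :=
  pdomain D /\ exists B : 'M[C]_(n.*2.+2, n.+1), nplane B /\ forall v, plane_pts B v -> D v.

Definition typeL {n} (G : 'M[C]_(n.*2.+2) -> Prop) : Prop :=
  pgl_subgroup G /\ pgl_discrete G /\
  exists D, large D /\ forall v, D v -> discontinuity_region G v.

End Defs.

(* Main.v *)
(* Let T be the limit of normalized representatives of the exterior powers of a
   normal sequence, and let L0 be an n-plane contained in a domain of
   discontinuity. The planes meeting L0 are cut out of the Grassmannian by one
   linear form phi. If phi vanished on T p for a Pluecker vector p with T p <> 0,
   the limit plane T p would meet L0, which is excluded. So T p = 0 as soon as
   phi (T p) = 0, and this forces T = u * (phi T), of rank one. Consequently: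
   - each limit plane is the limit image of a rank-one T, a condition that passes
     to limits of diagonal sequences, so the limit set is closed;
   - a normal sequence moves a generic plane close to L0, which lies in the
     discontinuity region, towards any given limit plane, so that no limit plane
     meets the interior of the limit set. *)

Require Import Defs.
From mathcomp Require Import all_boot all_order all_algebra all_fingroup.
From mathcomp Require Import boolp classical_sets reals complex ring lra.
Set Implicit Arguments.
Unset Strict Implicit.
Unset Printing Implicit Defensive.
Import Order.TTheory GRing.Theory Num.Theory.
Local Open Scope ring_scope.

(** * Pluecker vectors *)

(** A nonzero [q] has fewer than [size q] roots, so the [size q] distinct values from index [N] on
    cannot all be roots. For [x] tending to 0 this gives nonroots arbitrarily close to 0. *)
Lemma poly_nonroot (F : idomainType) (q : {poly F}) (x : nat -> F) N :
  q != 0 -> injective x -> exists2 k, (N <= k)%N & q.[x k] != 0.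
Proof.
move=> q0 xI; apply: contrapT => H.
have Hall : all (root q) [seq x k | k <- iota N (size q)].
  apply/allP=> _ /mapP[k + ->]; rewrite mem_iota => /andP[Nk _].
  by rewrite /root; apply/negPn/negP=> qk; apply: H; exists k.
have := max_poly_roots q0 Hall.
by rewrite map_inj_uniq // iota_uniq size_map size_iota ltnn => /(_ isT).
Qed.

Lemma poly_eval0 (F : numDomainType) (q : {poly F}) :
  (forall t, q.[t] = 0) -> q = 0.
Proof.
move=> H; apply/eqP/negPn/negP=> q0.
have [k _] := poly_nonroot (x := fun k => k%:R) 0 q0 (mulrIn (oner_neq0 _)).
by rewrite H eqxx.
Qed.

Lemma scalemx_entry (K : pzRingType) p q (a : K) (M : 'M_(p, q)) i j :
  (a *: M) i j = a * M i j.
Proof. by rewrite mxE. Qed.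

Lemma addmx_entry (K : pzRingType) p q (M M' : 'M[K]_(p, q)) i j :
  (M + M') i j = M i j + M' i j.
Proof. by rewrite mxE. Qed.

(** * Row selections indexed by subsets of size n+1 *)

Section RowsOf.
Variable n : nat.
Implicit Type S : {set 'I_(n.*2.+2)}.

Lemma rows_of_inj S : #|S| = n.+1 -> injective (fun a : 'I_n.+1 => rows_of S a).
Proof.
move=> cS a b /eqP; rewrite /rows_of nth_uniq ?enum_uniq -?cardE ?cS //.
by move/eqP/val_inj.
Qed.

Lemma rows_of_in S (a : 'I_n.+1) : #|S| = n.+1 -> rows_of S a \in S.
Proof. by move=> cS; rewrite -mem_enum mem_nth // -cardE cS. Qed.

Lemma rows_of_surj S x :
  #|S| = n.+1 -> x \in S -> exists a : 'I_n.+1, rows_of S a = x.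
Proof.
move=> cS xS; have lt : (index x (enum S) < n.+1)%N.
  by rewrite -cS cardE index_mem mem_enum.
by exists (Ordinal lt); rewrite /rows_of nth_index // mem_enum.
Qed.

Lemma card_plset (i : 'I_(pldim n)) : #|plset i| = n.+1.
Proof. exact/eqP/(valP (enum_val i)). Qed.

Lemma plset_inj : injective (@plset n).
Proof. by move=> i j /val_inj/enum_val_inj. Qed.

Lemma plset_surj S : #|S| = n.+1 -> exists i, plset i = S.
Proof.
move/eqP=> cS; pose s : plidx n := Sub S cS.
by exists (enum_rank s); rewrite /plset enum_rankK SubK.
Qed.

Lemma plset_rows_perm (f : 'I_n.+1 -> 'I_(n.*2.+2)) : injective f ->
  exists i (s : 'S_n.+1), forall a, f a = rows_of (plset i) (s a).
Proof.
move=> fI; have [i iE] : exists i, plset i = [set f a | a in 'I_n.+1].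
  by apply: plset_surj; rewrite card_imset // card_ord.
have /choice[s sE] a : exists b : 'I_n.+1, rows_of (plset i) b = f a.
  by apply: rows_of_surj; rewrite ?card_plset // iE imset_f.
have sI : injective s by move=> a b sab; apply: fI; rewrite -!sE sab.
by exists i, (perm sI) => a; rewrite permE sE.
Qed.

End RowsOf.

(** * A criterion for a matrix to have rank one *)

Section RankOne.
Variables (F : numFieldType) (r k p : nat) (P : 'M[F]_(r, k) -> 'cV[F]_p).
(** The three properties of Pluecker vectors that the criterion rests on: multilinearity in the
    columns, polynomial dependence along a line of frames, and spanning. *)
Hypothesis P_pencil : forall (B B1 B2 : 'M[F]_(r, k)) j0 b c,
  (forall i, B i j0 = b * B1 i j0 + c * B2 i j0) ->
  (forall i j, j != j0 -> B1 i j = B i j) ->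
  (forall i j, j != j0 -> B2 i j = B i j) ->
  P B = b *: P B1 + c *: P B2.
Hypothesis P_line_poly : forall (lam : 'rV[F]_p) (B D : 'M[F]_(r, k)),
  exists q : {poly F}, forall t, (lam *m P (B + t *: D)) 0 0 = q.[t].
Hypothesis P_span : forall m (A A' : 'M[F]_(m, p)),
  (forall B, A *m P B = A' *m P B) -> A = A'.

(* On two frames differing in one column, the hypothesis applies to a third
   frame with the same other columns, where [lam] vanishes. Any two frames are
   joined by exchanging one column at a time; the intermediate frames are
   replaced by generic ones, on a line through [B0], so that [lam] does not
   vanish on them. *)
Lemma rank_one_criterion m (T : 'M[F]_(m, p)) (lam : 'rV[F]_p) :
  (forall B, (lam *m P B) 0 0 = 0 -> T *m P B = 0) ->
  exists u : 'cV[F]_m, T = u *m lam.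
Proof.
move=> H; pose l B := (lam *m P B) 0 0.
have [[B0 l0]|nz] := pselect (exists B, l B != 0); last first.
  exists 0; rewrite mul0mx; apply: P_span => B; rewrite mul0mx H //.
  by apply/eqP/negPn/negP=> lB; apply: nz; exists B.
have adj (B B' : 'M[F]_(r, k)) j0 : (forall i j, j != j0 -> B' i j = B i j) ->
    l B *: (T *m P B') = l B' *: (T *m P B).
  move=> BB'; pose B'' : 'M[F]_(r, k) := \matrix_(i, j)
    if j == j0 then l B * B' i j + (- l B') * B i j else B i j.
  have PB'' : P B'' = l B *: P B' + (- l B') *: P B.
    apply: (P_pencil (j0 := j0)) => [i|i j /negPf jj|i j /negPf jj].
    - by rewrite mxE eqxx.
    - by rewrite mxE jj BB' // jj.
    - by rewrite mxE jj.
  have : T *m P B'' = 0.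
    apply: H; rewrite PB'' mulmxDr -!scalemxAr addmx_entry !scalemx_entry.
    by rewrite -/(l B) -/(l B') mulNr mulrC subrr.
  rewrite PB'' mulmxDr -!scalemxAr scaleNr => /eqP.
  by rewrite subr_eq0 => /eqP.
suff key B : l B0 *: (T *m P B) = l B *: (T *m P B0).
  exists ((l B0)^-1 *: (T *m P B0)).
  apply: P_span => B; rewrite -mulmxA [lam *m _]mx11_scalar -/(l B).
  rewrite mul_mx_scalar scalerA mulrC -scalerA -key scalerA mulVf //.
  by rewrite scale1r.
(* [B0 + t *: D d] moves only the first [d] columns towards [B]. The induction on [d] keeps [t]
   free, so that values of [t] where [l] vanishes can be crossed by a polynomial identity. *)
pose D (d : nat) : 'M[F]_(r, k) :=
  \matrix_(i, j) if (j < d)%N then B i j - B0 i j else 0.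
suff /(_ k 1) : forall d t, l B0 *: (T *m P (B0 + t *: D d))
    = l (B0 + t *: D d) *: (T *m P B0).
  have -> : B0 + 1 *: D k = B.
    by apply/matrixP=> i j; rewrite !mxE ltn_ord mul1r addrC subrK.
  by [].
elim=> [t|d IH].
  have -> : B0 + t *: D 0 = B0 by apply/matrixP=> i j; rewrite !mxE mulr0 addr0.
  by [].
have [dk|kd] := ltnP d k; last first.
  have -> : D d.+1 = D d.
    by apply/matrixP=> i j; rewrite !mxE !(leq_trans (ltn_ord j)) // ltnW.
  exact: IH.
move=> t; apply/colP=> i; rewrite !scalemx_entry; apply/eqP; rewrite -subr_eq0.
have [q qE] : exists q : {poly F}, forall t, l (B0 + t *: D d) = q.[t].
  exact: P_line_poly.
have [w wE] : exists w : 'rV_p, forall A, (w *m P A) 0 0 =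
    l B0 * (T *m P A) i 0 - l A * (T *m P B0) i 0.
  exists (l B0 *: row i T - (T *m P B0) i 0 *: lam) => A.
  have mE a b k' (M M' : 'cV[F]_k') j :
    (a *: M - b *: M') j 0 = a * M j 0 - b * M' j 0 by rewrite !mxE.
  have rE (M : 'cV[F]_m) : row i M 0 0 = M i 0 by rewrite mxE.
  by rewrite mulmxBl -!scalemxAl -row_mul mE rE [X in _ - X]mulrC.
have [s sE] := P_line_poly w B0 (D d.+1).
suff s0 : s = 0 by rewrite -wE sE s0 horner0.
(* Multiplied by [l (B0 + t *: D d)], the wanted identity follows from [adj] and the induction
   hypothesis. The factor [q] takes the value [l B0] at 0, hence is a nonzero polynomial and
   cancels. *)
have qs : q * s = 0.
  apply: poly_eval0 => x; rewrite hornerM -qE -sE wE.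
  have e : l (B0 + x *: D d) *: (T *m P (B0 + x *: D d.+1)) =
           l (B0 + x *: D d.+1) *: (T *m P (B0 + x *: D d)).
    apply: (adj _ _ (Ordinal dk)) => a b; rewrite -val_eqE /= => bd.
    by rewrite !mxE ltnS leq_eqVlt (negPf bd).
  have IHi := congr1 (fun M : 'cV_m => M i 0) (IH x); rewrite !scalemx_entry in IHi.
  have ei := congr1 (fun M : 'cV_m => M i 0) e; rewrite !scalemx_entry in ei.
  by rewrite mulrBr mulrCA ei mulrCA IHi mulrCA subrr.
have : q != 0.
  apply: contraNneq l0 => q0; have := qE 0.
  by rewrite scale0r addr0 q0 horner0 => ->.
by move/eqP: qs; rewrite mulf_eq0 => /orP[/eqP->|/eqP]; rewrite ?eqxx.
Qed.

End RankOne.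

(** * Pluecker coordinates, exterior powers and affine charts *)

Section Plucker.
Variables (R : realType) (n : nat).
Local Notation C := R[i].
Local Notation frame := 'M[C]_(n.*2.+2, n.+1).
Implicit Types (B : frame) (p : 'cV[C]_(pldim n)) (lam : 'rV[C]_(pldim n)).

Definition plrows B (j : 'I_(pldim n)) : 'M[C]_n.+1 :=
  \matrix_(a, b) B (rows_of (plset j) a) b.

Lemma pluckerE B j : plucker B j 0 = \det (plrows B j).
Proof. by rewrite mxE. Qed.

Definition std_frame (j : 'I_(pldim n)) : frame :=
  \matrix_(i, b) (i == rows_of (plset j) b)%:R.

Lemma plucker_std_frame j : plucker (std_frame j) = delta_mx j 0.
Proof.
apply/colP=> i; rewrite pluckerE mxE andbT; case: (eqVneq i j) => [->|ij].
  rewrite -[RHS](det1 C n.+1); congr (\det _); apply/matrixP=> a b; rewrite !mxE.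
  by rewrite (inj_eq (rows_of_inj (card_plset j))).
(* Distinct sets of equal size: a row index in [plset i] but not in [plset j] gives a zero row of
   the minor. *)
have /subsetPn[x xi xj] : ~~ (plset i \subset plset j).
  apply: contraNN ij => sij; apply/eqP/plset_inj/eqP.
  by rewrite eqEcard sij !card_plset /=.
have [a aE] := rows_of_surj (card_plset i) xi.
rewrite (expand_det_row _ a) big1 // => b _; rewrite !mxE aE.
case: eqP xj => [->|]; last by rewrite mul0r.
by rewrite rows_of_in // card_plset.
Qed.

(** An injective row choice is an increasing one up to a permutation, which costs a sign; a repeated
    row kills the minor. *)
Lemma minor_linear (f : 'I_n.+1 -> 'I_(n.*2.+2)) : exists lam, forall B,
  \det (\matrix_(a < n.+1, b < n.+1) B (f a) b) = (lam *m plucker B) 0 0.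
Proof.
have [/injectiveP fI|/injectivePn[a [b ab fab]]] := boolP (injectiveb f).
  have [i [s sE]] := plset_rows_perm fI.
  exists ((-1) ^+ s *: delta_mx 0 i) => B.
  rewrite -scalemxAl -rowE !mxE -det_perm -det_mulmx; congr (\det _).
  by rewrite -row_permE; apply/matrixP=> a b; rewrite !mxE sE.
exists 0 => B; rewrite mul0mx mxE.
by apply: (determinant_alternate ab) => c; rewrite !mxE fab.
Qed.

(** Cauchy-Binet before grouping the maps [f] by their images. *)
Lemma det_mulmx_minors (K : 'M[C]_(n.+1, n.*2.+2)) B :
  \det (K *m B) = \sum_(f : {ffun 'I_n.+1 -> 'I_(n.*2.+2)})
    (\prod_a K a (f a)) * \det (\matrix_(a < n.+1, b < n.+1) B (f a) b).
Proof.
rewrite /determinant; under [RHS]eq_bigr do rewrite mulr_sumr.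
rewrite exchange_big; apply: eq_bigr => s _ /=.
under eq_bigr do rewrite mxE.
rewrite bigA_distr_bigA mulr_sumr; apply: eq_bigr => f _ /=.
rewrite big_split /= mulrCA; congr (_ * (_ * _)).
by apply: eq_bigr => a _; rewrite mxE.
Qed.

(* The coefficients are read off on the standard frames, whose Pluecker
   vectors form the standard basis. *)
Definition plform (K : 'M[C]_(n.+1, n.*2.+2)) : 'rV[C]_(pldim n) :=
  \row_j \det (K *m std_frame j).

Lemma plformE K B : \det (K *m B) = (plform K *m plucker B) 0 0.
Proof.
suff [lam lamE] : exists lam, forall B, \det (K *m B) = (lam *m plucker B) 0 0.
  suff -> : plform K = lam by [].
  by apply/rowP=> j; rewrite mxE lamE plucker_std_frame -colE mxE.
have /choice[l lE] := @minor_linear.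
exists (\sum_(f : {ffun 'I_n.+1 -> 'I_(n.*2.+2)}) (\prod_a K a (f a)) *: l f) => A.
rewrite det_mulmx_minors mulmx_suml summxE; apply: eq_bigr => f _.
by rewrite lE -scalemxAl [RHS]mxE.
Qed.

Lemma plrowsE B j :
  plrows B j = (\matrix_(a, i) (rows_of (plset j) a == i)%:R) *m B.
Proof.
apply/matrixP=> a b; rewrite !mxE (bigD1 (rows_of (plset j) a)) //= big1.
  by rewrite mxE eqxx mul1r addr0.
by move=> i; rewrite eq_sym => /negPf ne; rewrite mxE ne mul0r.
Qed.

(** By Cauchy-Binet: row [i] of [ext_pow A] is [plform] of the rows of [A] selected by [plset i]. *)
Lemma plucker_mul A B : plucker (A *m B) = ext_pow A *m plucker B.
Proof.
apply/colP=> i; rewrite pluckerE plrowsE mulmxA plformE !mxE.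
apply: eq_bigr => j _; congr (_ * _); rewrite !mxE; congr (\det _).
rewrite -mulmxA -plrowsE; apply/matrixP=> a b; rewrite !mxE.
rewrite (bigD1 (rows_of (plset j) b)) //= big1; first by rewrite mxE eqxx mulr1 addr0.
by move=> c ne; rewrite mxE (negPf ne) mulr0.
Qed.

Lemma eq_on_plucker m (A A' : 'M[C]_(m, pldim n)) :
  (forall B, A *m plucker B = A' *m plucker B) -> A = A'.
Proof.
move=> H; apply/matrixP=> i j; move/matrixP/(_ i 0): (H (std_frame j)).
by rewrite plucker_std_frame -!colE !mxE.
Qed.

Lemma ext_powM A A' : ext_pow (A *m A') = ext_pow A *m ext_pow A' :> 'M[C]_(pldim n).
Proof. by apply: eq_on_plucker => B; rewrite -mulmxA -!plucker_mul mulmxA. Qed.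

Lemma ext_pow1 : ext_pow 1%:M = 1%:M :> 'M[C]_(pldim n).
Proof. by apply: eq_on_plucker => B; rewrite -plucker_mul !mul1mx. Qed.

Lemma ext_pow_unit (A : 'M[C]_(n.*2.+2)) :
  A \in unitmx -> ext_pow A \in unitmx.
Proof.
move=> Au; have : ext_pow A *m ext_pow (invmx A) = 1%:M.
  by rewrite -ext_powM mulmxV // ext_pow1.
by case/mulmx1_unit.
Qed.

Lemma plucker_mulr B (M : 'M[C]_n.+1) : plucker (B *m M) = \det M *: plucker B.
Proof.
apply/colP=> j; rewrite pluckerE plrowsE mulmxA det_mulmx -plrowsE.
by rewrite -pluckerE mulrC [RHS]mxE.
Qed.

(** A nonzero minor forces full rank. Conversely, for a left inverse [K] of [B], the form [plform K]
    takes the value 1 on [plucker B]. *)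
Lemma plucker_neq0 B : (plucker B != 0) = (\rank B == n.+1).
Proof.
apply/idP/idP => [/cV0Pn[j]|/eqP rB].
  rewrite pluckerE -unitfE -unitmxE plrowsE => u.
  rewrite eqn_leq rank_leq_col /= -[X in (X <= _)%N](mxrank_unit u).
  exact: mxrankM_maxr.
have /row_fullP[K KB] : row_full B by rewrite /row_full rB.
apply/negP=> /eqP B0; have /eqP := plformE K B.
by rewrite KB B0 mulmx0 det1 mxE oner_eq0.
Qed.

(* Over the vectors [plucker B] this is [B *m \adj (plrows B j)], by Cramer's rule. *)
Definition chart (j : 'I_(pldim n)) p : frame :=
  \matrix_(i, a) (plform (\matrix_(b, c)
    ((if b == a then i else rows_of (plset j) b) == c)%:R) *m p) 0 0.

Lemma chart_plucker j B : chart j (plucker B) = B *m \adj (plrows B j).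
Proof.
apply/matrixP=> i a; rewrite mxE -plformE.
set M := _ *m B; have ME b c :
    M b c = if b == a then B i c else plrows B j b c.
  rewrite mxE (bigD1 (if b == a then i else rows_of (plset j) b)) //= big1.
    by rewrite mxE eqxx mul1r addr0; case: eqP => //; rewrite !mxE.
  by move=> x; rewrite eq_sym => /negPf ne; rewrite mxE ne mul0r.
rewrite (expand_det_row M a) mxE; apply: eq_bigr => b _.
rewrite ME eqxx; congr (_ * _); rewrite !mxE; congr (_ * \det _).
apply/matrixP=> c d; do 2!rewrite [LHS]mxE; do 2!rewrite [RHS]mxE.
by rewrite ME eq_sym (negPf (neq_lift _ _)).
Qed.

(** A point of the plane is located by its coordinates in the rows [plset j] alone. There is no
    division, so the identity passes to limits of planes and points. *)
Lemma chart_incidence j B (x : 'cV[C]_n.+1) :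
  chart j (plucker B) *m (plrows B j *m x) = plucker B j 0 *: (B *m x).
Proof.
rewrite chart_plucker -mulmxA [\adj _ *m _]mulmxA mul_adj_mx pluckerE.
by rewrite mul_scalar_mx scalemxAr.
Qed.

Lemma chartZ j c p : chart j (c *: p) = c *: chart j p.
Proof.
apply/matrixP=> i a.
by rewrite [LHS]mxE -scalemxAr !scalemx_entry [chart _ _ _ _]mxE.
Qed.

(** From [\det M * \det (\adj M) = \det M ^+ n.+1] for [M] of size n+1. The factor [p j 0] kept on
    the left makes the identity hold even where [p j 0] vanishes. *)
Lemma plucker_chart j c B : let p := c *: plucker B in
  p j 0 *: plucker (chart j p) = p j 0 ^+ n.+1 *: p.
Proof.
move=> p; have -> : chart j p = B *m (c *: \adj (plrows B j)).
  by rewrite chartZ chart_plucker scalemxAr.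
rewrite plucker_mulr detZ scalerA /p mxE pluckerE scalerA; congr (_ *: _).
have -> : c * \det (plrows B j) * (c ^+ n.+1 * \det (\adj (plrows B j)))
   = c ^+ n.+1 * c * (\det (plrows B j *m \adj (plrows B j))).
  by rewrite det_mulmx; ring.
by rewrite mul_mx_adj det_scalar exprMn; ring.
Qed.

Lemma plucker_pencil (B B1 B2 : frame) j0 b c :
  (forall i, B i j0 = b * B1 i j0 + c * B2 i j0) ->
  (forall i j, j != j0 -> B1 i j = B i j) ->
  (forall i j, j != j0 -> B2 i j = B i j) ->
  plucker B = b *: plucker B1 + c *: plucker B2.
Proof.
move=> H0 H1 H2; apply/colP=> j; rewrite addmx_entry !scalemx_entry !pluckerE.
rewrite -![\det (plrows _ _)]det_tr; apply: (determinant_multilinear (i0 := j0)).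
- by apply/rowP=> a; rewrite !mxE H0.
- by apply/matrixP=> x y; rewrite !mxE H1 // eq_sym neq_lift.
- by apply/matrixP=> x y; rewrite !mxE H2 // eq_sym neq_lift.
Qed.

Lemma plucker_line_poly lam (B D : frame) :
  exists q : {poly C}, forall t, (lam *m plucker (B + t *: D)) 0 0 = q.[t].
Proof.
exists (\sum_j (lam 0 j)%:P * \det (\matrix_(a < n.+1, b < n.+1)
  ((B (rows_of (plset j) a) b)%:P + (D (rows_of (plset j) a) b) *: 'X))) => t.
rewrite horner_sum mxE; apply: eq_bigr => j _.
rewrite hornerM hornerC pluckerE; congr (_ * _).
rewrite -[RHS]/(horner_eval t _) -det_map_mx; congr (\det _).
by apply/matrixP=> a b; rewrite !mxE /= horner_evalE hornerD hornerC hornerZ hornerX mulrC.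
Qed.

(** Let the rows of [K] span the left kernel of [B], of dimension (2n+2)-(n+1) = n+1. Then [K *m E]
    is square, and a null vector [x] of it gives a point [E *m x] killed by [K], hence in the image
    of [B]. *)
Lemma meet_form B : \rank B = n.+1 -> exists lam, forall E : frame,
  \rank E = n.+1 -> (lam *m plucker E) 0 0 = 0 ->
  exists2 v, plane_pts E v & plane_pts B v.
Proof.
move=> rB.
have : exists K : 'M[C]_(\rank (kermx B), n.*2.+2), (K :=: kermx B)%MS.
  by exists (row_base (kermx B)); apply: eq_row_base.
have -> : \rank (kermx B) = n.+1.
  by rewrite mxrank_ker rB subSS -addnn subSn ?addnK // leq_addr.
case=> K KE; have rK : \rank K = n.+1.
  by rewrite KE mxrank_ker rB subSS -addnn subSn ?addnK // leq_addr.
have KB : (B^T <= kermx K^T)%MS.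
  apply/sub_kermxP; rewrite -trmx_mul.
  by have /sub_kermxP -> : (K <= kermx B)%MS; rewrite ?KE ?trmx0.
exists (plform K) => E rE; rewrite -plformE => d0.
have /det0P[x x0 xKE] : \det (K *m E)^T == 0 by rewrite det_tr d0.
have Ex0 : x *m E^T != 0.
  apply: contraNneq x0 => xE0.
  have /row_freeP[E' EE'] : row_free E^T by rewrite /row_free mxrank_tr rE.
  by rewrite -(mulmx1 x) -EE' mulmxA xE0 mul0mx.
(* The inclusion [KB] is between spaces of equal rank, so it is an equality. *)
have /submxP[y yE] : (x *m E^T <= B^T)%MS.
  have rBt : \rank B^T = \rank (kermx K^T).
    by rewrite mxrank_ker !mxrank_tr rB rK subSS -addnn subSn ?addnK // leq_addr.
  have [_] := mxrank_leqif_eq KB; rewrite rBt eqxx => /esym e.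
  apply: submx_trans (proj2 (andP e)).
  by apply/sub_kermxP; rewrite -mulmxA -trmx_mul.
exists (x *m E^T)^T; split; rewrite ?trmx_eq0 //.
  by exists x^T; rewrite trmx_mul trmxK.
by exists y^T; rewrite yE trmx_mul trmxK.
Qed.

Lemma plucker_rank_one m (T : 'M[C]_(m, pldim n)) lam :
  (forall B, (lam *m plucker B) 0 0 = 0 -> T *m plucker B = 0) ->
  exists u : 'cV[C]_m, T = u *m lam.
Proof.
apply: rank_one_criterion; first exact: plucker_pencil.
  exact: plucker_line_poly.
exact: eq_on_plucker.
Qed.

End Plucker.

(** * Limits of complex sequences *)

Section Limits.
Variable F : numFieldType.
Implicit Types (a b : nat -> F) (l m : F).

(** A general [numFieldType] covers both [R] and [R[i]]; in the latter, [0 < e] forces [e] to be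
    real. *)
Definition scvg a l := forall e, 0 < e ->
  exists N, forall nu, (N <= nu)%N -> `|a nu - l| < e.

Lemma scvg_cst l : scvg (fun=> l) l.
Proof. by move=> e e0; exists 0 => nu _; rewrite subrr normr0. Qed.

Lemma eq_scvg a b l : a =1 b -> scvg a l -> scvg b l.
Proof. by move=> ab H e /H[N HN]; exists N => nu /HN; rewrite ab. Qed.

Lemma scvgD a b l m : scvg a l -> scvg b m -> scvg (fun k => a k + b k) (l + m).
Proof.
move=> al bm e e0; have e2 : 0 < e / 2 by rewrite divr_gt0 ?ltr0n.
have [N HN] := al _ e2; have [M HM] := bm _ e2; exists (maxn N M) => nu.
rewrite geq_max => /andP[/HN h1 /HM h2]; rewrite opprD addrACA.
by rewrite (le_lt_trans (ler_normD _ _)) // [e]splitr ltrD.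
Qed.

Lemma scvgM a b l m : scvg a l -> scvg b m -> scvg (fun k => a k * b k) (l * m).
Proof.
(* The summand [e] in [s] makes [e / s < 1], which bounds the product of the two errors by
   [e / s]. *)
move=> al bm e e0; pose s := 1 + `|l| + `|m| + e.
have s0 : 0 < s by rewrite ltr_wpDl // !addr_ge0.
have d0 : 0 < e / s by rewrite divr_gt0.
have d1 : e / s < 1 by rewrite ltr_pdivrMr // mul1r ltrDr !ltr_wpDr.
have [N HN] := al _ d0; have [M HM] := bm _ d0; exists (maxn N M) => nu.
rewrite geq_max => /andP[/HN h1 /HM h2].
have -> : a nu * b nu - l * m =
  (a nu - l) * (b nu - m) + (l * (b nu - m) + (a nu - l) * m) by ring.
rewrite (le_lt_trans (ler_normD _ _)) //.
have h3 : `|l * (b nu - m) + (a nu - l) * m| <= `|l| * (e / s) + e / s * `|m|.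
  rewrite (le_trans (ler_normD _ _)) // !normrM lerD //.
    by rewrite ler_wpM2l // ltW.
  by rewrite ler_wpM2r // ltW.
have h4 : `|(a nu - l) * (b nu - m)| < e / s * 1.
  by rewrite normrM ltr_pM // (lt_trans h2).
rewrite (lt_le_trans (ltr_leD h4 h3)) //.
have -> : e / s * 1 + (`|l| * (e / s) + e / s * `|m|) = e / s * (1 + `|l| + `|m|) by ring.
rewrite mulrAC ler_pdivrMr // ler_pM2l //.
by rewrite lerDl ltW.
Qed.

Lemma scvg_sum (I : Type) (r : seq I) (P : pred I) (a : I -> nat -> F) (l : I -> F) :
  (forall i, scvg (a i) (l i)) ->
  scvg (fun k => \sum_(i <- r | P i) a i k) (\sum_(i <- r | P i) l i).
Proof.
move=> H; elim: r => [|i r IH].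
  by rewrite big_nil; apply: eq_scvg (scvg_cst _) => k; rewrite big_nil.
rewrite big_cons; case: ifP => Pi; last first.
  by apply: eq_scvg IH => k; rewrite big_cons Pi.
by apply: eq_scvg (scvgD (H i) IH) => k; rewrite big_cons Pi.
Qed.

Lemma scvg_prod (I : Type) (r : seq I) (P : pred I) (a : I -> nat -> F) (l : I -> F) :
  (forall i, scvg (a i) (l i)) ->
  scvg (fun k => \prod_(i <- r | P i) a i k) (\prod_(i <- r | P i) l i).
Proof.
move=> H; elim: r => [|i r IH].
  by rewrite big_nil; apply: eq_scvg (scvg_cst _) => k; rewrite big_nil.
rewrite big_cons; case: ifP => Pi; last first.
  by apply: eq_scvg IH => k; rewrite big_cons Pi.
by apply: eq_scvg (scvgM (H i) IH) => k; rewrite big_cons Pi.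
Qed.

Lemma scvg_uniq a l m : scvg a l -> scvg a m -> l = m.
Proof.
move=> al am; apply/eqP; rewrite -subr_eq0 -normr_le0.
have r : `|l - m| \is Num.real by rewrite normr_real.
have [//|p] := real_leP r (real0 _).
have p2 : 0 < `|l - m| / 2 by rewrite divr_gt0 ?ltr0n.
have [N HN] := al _ p2; have [M HM] := am _ p2.
have := ltrD (HN _ (leq_maxl N M)) (HM _ (leq_maxr N M)).
rewrite -splitr distrC => /(le_lt_trans (ler_normD _ _)).
by rewrite addrA subrK ltxx.
Qed.

Lemma scvg_near a b l d : scvg d 0 -> (forall k, `|b k - a k| < d k) ->
  scvg a l -> scvg b l.
Proof.
move=> d0 ab al e e0; have e2 : 0 < e / 2 by rewrite divr_gt0 ?ltr0n.
have [N HN] := al _ e2; have [M HM] := d0 _ e2; exists (maxn N M) => nu.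
rewrite geq_max => /andP[/HN h1 /HM]; rewrite subr0.
have dnu : 0 < d nu by apply: le_lt_trans (ab nu).
rewrite gtr0_norm // => h2.
rewrite -(subrK (a nu) (b nu)) -addrA (le_lt_trans (ler_normD _ _)) //.
by rewrite [e]splitr ltrD // (lt_trans (ab nu)).
Qed.

Lemma scvg_sub a l (phi : nat -> nat) :
  (forall k, (k <= phi k)%N) -> scvg a l -> scvg (a \o phi) l.
Proof.
move=> H al e /al[N HN]; exists N => nu Nnu; apply: HN.
exact: leq_trans (H nu).
Qed.

Lemma scvg_neq0 a l : scvg a l -> l != 0 -> exists N, forall nu, (N <= nu)%N -> a nu != 0.
Proof.
move=> al l0; have [|N HN] := al `|l|; first by rewrite normr_gt0.
exists N => nu /HN; apply: contraTneq => ->.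
by rewrite sub0r normrN ltxx.
Qed.

Definition mcvg p q (A : nat -> 'M[F]_(p, q)) (T : 'M[F]_(p, q)) :=
  forall i j, scvg (fun k => A k i j) (T i j).

Lemma mcvg_cst p q (T : 'M[F]_(p, q)) : mcvg (fun=> T) T.
Proof. by move=> i j; apply: scvg_cst. Qed.

Lemma eq_mcvg p q (A B : nat -> 'M[F]_(p, q)) T : A =1 B -> mcvg A T -> mcvg B T.
Proof. by move=> AB H i j; apply: eq_scvg (H i j) => k; rewrite AB. Qed.

Lemma mcvg_mul p q r (A : nat -> 'M[F]_(p, q)) (B : nat -> 'M[F]_(q, r)) S T :
  mcvg A S -> mcvg B T -> mcvg (fun k => A k *m B k) (S *m T).
Proof.
move=> AS BT i j; rewrite mxE; apply: eq_scvg; last first.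
  by apply: scvg_sum => l; apply: scvgM (AS i l) (BT l j).
by move=> k; rewrite mxE.
Qed.

Lemma mcvgD p q (A B : nat -> 'M[F]_(p, q)) S T :
  mcvg A S -> mcvg B T -> mcvg (fun k => A k + B k) (S + T).
Proof.
move=> AS BT i j; rewrite mxE.
by apply: eq_scvg (scvgD (AS i j) (BT i j)) => k; rewrite mxE.
Qed.

Lemma mcvgZ p q a l (A : nat -> 'M[F]_(p, q)) T :
  scvg a l -> mcvg A T -> mcvg (fun k => a k *: A k) (l *: T).
Proof.
move=> al AT i j; rewrite mxE.
by apply: eq_scvg (scvgM al (AT i j)) => k; rewrite mxE.
Qed.

Lemma mcvg_det p (A : nat -> 'M[F]_p) T : mcvg A T -> scvg (fun k => \det (A k)) (\det T).
Proof.
move=> AT; apply: scvg_sum => s; apply: scvgM; first exact: scvg_cst.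
by apply: scvg_prod => i; apply: AT.
Qed.

Lemma mcvg_uniq p q (A : nat -> 'M[F]_(p, q)) S T : mcvg A S -> mcvg A T -> S = T.
Proof. by move=> AS AT; apply/matrixP=> i j; apply: scvg_uniq (AS i j) (AT i j). Qed.

Lemma mcvg_sub p q (A : nat -> 'M[F]_(p, q)) T (phi : nat -> nat) :
  (forall k, (k <= phi k)%N) -> mcvg A T -> mcvg (A \o phi) T.
Proof. by move=> H AT i j; apply: (scvg_sub H (AT i j)). Qed.

(* If two rescalings of the same sequence converge, the limits are proportional;
   this is the division-free form of that fact. *)
Lemma mcvg_cross p q (A : nat -> 'M[F]_(p, q)) c c' S T :
  mcvg (fun k => c k *: A k) S -> mcvg (fun k => c' k *: A k) T ->
  forall i j i' j', S i j * T i' j' = S i' j' * T i j.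
Proof.
move=> AS AT i j i' j'; apply: scvg_uniq (scvgM (AS i j) (AT i' j')) _.
apply: eq_scvg (scvgM (AS i' j') (AT i j)) => k; rewrite !mxE; ring.
Qed.

Lemma mcvg_proportional p q (A : nat -> 'M[F]_(p, q)) c c' S T :
  mcvg (fun k => c k *: A k) S -> mcvg (fun k => c' k *: A k) T ->
  S != 0 -> T != 0 -> exists2 d, d != 0 & T = d *: S.
Proof.
move=> AS AT /matrix0Pn[i [j Sij]] T0.
have TE : T = (T i j / S i j) *: S.
  apply/matrixP=> x y; rewrite mxE; apply: (mulfI Sij).
  by rewrite (mcvg_cross AS AT i j x y); field.
by exists (T i j / S i j) => //; apply: contraNneq T0 => z; rewrite TE z scale0r.
Qed.

End Limits.

Section Subsequences.
Variable phi : nat -> nat.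
Hypothesis phi_incr : forall k, (phi k < phi k.+1)%N.

Lemma incr_geq_id k : (k <= phi k)%N.
Proof. by elim: k => // k IH; apply: leq_ltn_trans IH _. Qed.

Lemma incr_inj : injective phi.
Proof.
move=> i j e; have H := homo_ltn ltn_trans phi_incr.
by case: (ltngtP i j) => // /H; rewrite e ltnn.
Qed.
End Subsequences.

Lemma subseq_choice (P : nat -> nat -> Prop) :
  (forall k N, exists2 n, (N <= n)%N & P k n) ->
  exists phi : nat -> nat, (forall k, (phi k < phi k.+1)%N) /\ forall k, P k (phi k).
Proof.
move=> H; have /choice[f fP] : forall kN : nat * nat,
    exists n, (kN.2 <= n)%N /\ P kN.1 n by move=> [k N]; have [n ? ?] := H k N; exists n.
pose phi := fix phi k := if k is k'.+1 then f (k, (phi k').+1) else f (0, 0).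
exists phi; split=> k; first by have [] := fP (k.+1, (phi k).+1).
by case: k => [|k]; [have [] := fP (0, 0)|have [] := fP (k.+1, (phi k).+1)].
Qed.

(** * Compactness of bounded matrices and normalized representatives *)

Section BolzanoWeierstrass.
Local Open Scope complex_scope.
Variable R : realType.
Local Notation C := R[i].

Lemma inv_cvg0 : scvg (fun k => k.+1%:R^-1 : R) 0.
Proof.
move=> e e0; exists (Num.bound e^-1) => k kN; rewrite subr0 normfV normr_nat.
rewrite invf_plt ?posrE ?ltr0n // (lt_trans (archi_boundP _)) ?invr_ge0 ?ltW //.
by rewrite ltr_nat ltnS.
Qed.

Lemma bw_real (u : nat -> R) : (forall n, `|u n| <= 1) ->
  exists phi, (forall k, (phi k < phi k.+1)%N) /\ exists l, scvg (u \o phi) l.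
Proof.
(* [E] collects the bounds that [u] reaches infinitely often; its supremum is the upper limit of
   [u]. *)
move=> u1; pose E := [set x | forall N, exists2 n, (N <= n)%N & x <= u n]%classic.
have Es : has_sup E.
  split; first by exists (-1) => N; exists N => //; have := u1 N; rewrite ler_norml => /andP[].
  exists 1 => x /(_ 0)[n _ xn]; apply: le_trans xn _.
  by have := u1 n; rewrite ler_norml => /andP[].
pose l := sup E.
have H k N : exists2 n, (N <= n)%N & `|u n - l| < k.+1%:R^-1.
  have e0 : 0 < k.+1%:R^-1 :> R by rewrite invr_gt0 ltr0n.
  set e := _^-1 in e0 *.
  have [x Ex lx] := sup_adherent e0 Es.
  have [M HM] : exists M, forall n, (M <= n)%N -> u n < l + e.
    have : ~ E (l + e / 2) by move/(sup_upper_bound Es); rewrite -/l; lra.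
    move/existsNP => [M nM]; exists M => n Mn.
    rewrite ltNge; apply/negP=> le; apply: nM; exists n => //; lra.
  have [n nNM xn] := Ex (maxn N M); move: nNM; rewrite geq_max => /andP[Nn Mn].
  exists n => //; rewrite ltr_norml; have := HM n Mn; rewrite -/l in lx; lra.
have [phi [incr Hphi]] := subseq_choice H.
exists phi; split=> //; exists l; apply: (scvg_near inv_cvg0 _ (scvg_cst l)).
exact: Hphi.
Qed.

Lemma posC (e : C) : 0 < e -> exists2 r : R, 0 < r & e = r%:C.
Proof.
move=> e0; exists (complex.Re e); last by rewrite RRe_real // gtr0_real.
by move: e0; rewrite ltcE => /andP[].
Qed.

Lemma scvg_real (u : nat -> R) l : scvg u l -> scvg (fun k => (u k)%:C) l%:C.
Proof.
move=> ul _ /posC[e e0 ->]; have [N HN] := ul _ e0; exists N => nu /HN.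
by rewrite -rmorphB normc_def /= expr0n addr0 sqrtr_sqr ltcR.
Qed.

Lemma mx_cvgE p q (A : nat -> 'M[C]_(p, q)) T : mx_cvg A T <-> mcvg A T.
Proof.
split=> [AT i j _ /posC[e e0 ->]|AT e e0].
  by have [N HN] := AT e e0; exists N => nu /HN; apply.
have /choice[f fP] (ij : 'I_p * 'I_q) : exists N, forall nu, (N <= nu)%N ->
    `|A nu ij.1 ij.2 - T ij.1 ij.2| < e%:C.
  by apply: AT; rewrite ltcR.
exists (\max_ij f ij)%N => nu Hnu i j; apply: (fP (i, j)).
exact: leq_trans (leq_bigmax _) Hnu.
Qed.

Lemma inv_succ_cvg0 : scvg (fun k => k.+1%:R^-1 : C) 0.
Proof.
have := scvg_real inv_cvg0; apply: eq_scvg => k.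
by rewrite fmorphV rmorph_nat.
Qed.

Lemma mx_near_cvg p q (a : nat -> 'M[C]_(p, q)) T :
  (forall k, mx_near (a k) T k.+1%:R^-1) -> mcvg a T.
Proof.
move=> H i j; apply: scvg_near (inv_succ_cvg0) _ (scvg_cst (T i j)) => k.
by have := H k i j; rewrite fmorphV rmorph_nat.
Qed.

Lemma bw_complex (a : nat -> C) : (forall n, `|a n| <= 1) ->
  exists phi, (forall k, (phi k < phi k.+1)%N) /\ exists l, scvg (a \o phi) l.
Proof.
move=> a1.
have a1R z : `|z| <= 1 :> C -> `|complex.Re z| <= 1 :> R.
  by move=> z1; rewrite -lecR (le_trans (normc_ge_Re _)).
have [phi [incr [l Hl]]] := bw_real (fun n => a1R _ (a1 n)).
(* The real part of [a * 'i] is minus the imaginary part of [a]; this explains the factor [- 'i] in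
   the limit below. *)
have a1I n : `|complex.Re (a (phi n) * 'i%C)| <= 1.
  apply: a1R; rewrite normrM.
  have -> : `|'i%C : C| = 1 by rewrite normc_def /= expr0n expr1n add0r sqrtr1.
  by rewrite mulr1.
have [psi [incr' [m Hm]]] := bw_real a1I.
exists (phi \o psi); split=> [k|].
  exact: (homo_ltn ltn_trans incr).
exists (l%:C + (- 'i%C) * m%:C).
have := scvgD (scvg_real (scvg_sub (incr_geq_id incr') Hl))
  (scvgM (scvg_cst (- 'i%C)) (scvg_real Hm)).
apply: eq_scvg => k /=; rewrite ReiNIm rmorphN mulrNN.
by rewrite -complexE.
Qed.

Lemma bw_list (I : eqType) (r : seq I) (a : I -> nat -> C) :
  (forall i n, `|a i n| <= 1) ->
  exists phi, (forall k, (phi k < phi k.+1)%N) /\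
    forall i, i \in r -> exists l, scvg (a i \o phi) l.
Proof.
move=> a1; elim: r => [|i r [phi [incr IH]]]; first by exists id.
have [psi [incr' [l Hl]]] := bw_complex (fun n => a1 i (phi n)).
exists (phi \o psi); split=> [k|j]; first exact: (homo_ltn ltn_trans incr).
rewrite inE => /orP[/eqP->|/IH[m Hm]]; first by exists l.
by exists m; apply: (scvg_sub (incr_geq_id incr') Hm).
Qed.

Lemma bw_mx p q (A : nat -> 'M[C]_(p, q)) : (forall n i j, `|A n i j| <= 1) ->
  exists phi, (forall k, (phi k < phi k.+1)%N) /\ exists T, mcvg (A \o phi) T.
Proof.
move=> A1; have [] := bw_list (enum {: 'I_p * 'I_q})
  (a := fun ij n => A n ij.1 ij.2); first by move=> ij n; apply: A1.
move=> phi [incr H]; exists phi; split=> //.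
have /choice[f fP] (ij : 'I_p * 'I_q) :
    exists l, scvg (fun k => A (phi k) ij.1 ij.2) l.
  by apply: H; rewrite mem_enum.
by exists (\matrix_(i, j) f (i, j)) => i j; rewrite mxE; apply: (fP (i, j)).
Qed.

Lemma normalized_scale p q (A : 'M[C]_(p, q)) :
  A != 0 -> exists2 c, c != 0 & normalized (c *: A).
Proof.
move=> /matrix0Pn[i0 [j0 A0]].
(* Moduli live in the partially ordered [C]; their real parts live in [R], where a maximum
   exists. *)
pose f (ij : 'I_p * 'I_q) := complex.Re `|A ij.1 ij.2|.
have fE ij : `|A ij.1 ij.2| = (f ij)%:C by rewrite RRe_real // normr_real.
case: (@arg_maxP _ _ _ (i0, j0) xpredT f isT) => [[i j] _ max].
have Aij : A i j != 0.
  rewrite -normr_gt0 (fE (i, j)) (lt_le_trans _ (_ : (f (i0, j0))%:C <= _)) //.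
    by rewrite -fE normr_gt0.
  by rewrite lecR; apply: max.
exists (`|A i j|^-1); first by rewrite invr_eq0 normr_eq0.
split=> [x y|]; last first.
  by exists i, j; rewrite mxE normrM normfV normr_id mulVf // normr_eq0.
rewrite mxE normrM normfV normr_id mulrC ler_pdivrMr ?normr_gt0 // mul1r.
by rewrite (fE (i, j)) (fE (x, y)) lecR; apply: max.
Qed.

(** A zero limit would bring all entries below modulus 1, against the entry of modulus 1. *)
Lemma normalized_lim_neq0 p q (A : nat -> 'M[C]_(p, q)) T :
  (forall k, normalized (A k)) -> mcvg A T -> T != 0.
Proof.
move=> nA /mx_cvgE AT; apply/negP=> /eqP T0.
have [N HN] := AT 1 ltr01; have [_ [i [j e]]] := nA N.
by have := HN N (leqnn N) i j; rewrite T0 [X in _ - X]mxE subr0 e ltxx.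
Qed.

Lemma normalized_cvg_neq0 p (A : nat -> 'M[C]_p) T : normalized_cvg A T -> T != 0.
Proof. by move=> [c [_ [nA /mx_cvgE AT]]]; apply: normalized_lim_neq0 AT. Qed.

Lemma normalized_cvg_sub p (A : nat -> 'M[C]_p) T (phi : nat -> nat) :
  (forall k, (k <= phi k)%N) -> normalized_cvg A T -> normalized_cvg (A \o phi) T.
Proof.
move=> H [c [c0 [nA /mx_cvgE AT]]]; exists (c \o phi); split=> [nu|]; first exact: c0.
split=> [nu|]; first exact: nA.
by apply/mx_cvgE; apply: mcvg_sub AT.
Qed.

Lemma normalized_subseq p (A : nat -> 'M[C]_p) : (forall k, A k != 0) ->
  exists phi, (forall k, (phi k < phi k.+1)%N) /\ exists T, normalized_cvg (A \o phi) T.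
Proof.
move=> A0; have /choice[c cP] k : exists c, c != 0 /\ normalized (c *: A k).
  by have [c] := normalized_scale (A0 k); exists c.
have [|phi [incr [T HT]]] := @bw_mx p p (fun k => c k *: A k).
  by move=> k i j; have [_ []] := cP k.
exists phi; split=> //; exists T, (c \o phi); split=> [nu|]; first by case: (cP (phi nu)).
split=> [nu|]; first by case: (cP (phi nu)).
exact/mx_cvgE.
Qed.

End BolzanoWeierstrass.

(** * The limit set *)

Section LimitSet.
Variables (R : realType) (n : nat).
Local Notation C := R[i].
Local Notation frame := 'M[C]_(n.*2.+2, n.+1).
Local Notation pt := 'cV[C]_(n.*2.+2).
Implicit Types (B E : frame) (G : 'M[C]_(n.*2.+2) -> Prop) (v w : pt).

(** * Limit planes as images under limit maps *)

Lemma frame_mul_neq0 B (x : 'cV[C]_n.+1) : \rank B = n.+1 -> x != 0 -> B *m x != 0.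
Proof.
move=> rB; have /row_fullP[K KB] : row_full B by rewrite /row_full rB.
by apply: contraNneq => Bx; rewrite -(mul1mx x) -KB -mulmxA Bx mulmx0.
Qed.

Lemma rank_mul_unit (A : 'M[C]_(n.*2.+2)) B : A \in unitmx -> \rank (A *m B) = \rank B.
Proof.
move=> Au; rewrite -mxrank_tr trmx_mul mxrankMfree ?mxrank_tr //.
by rewrite row_free_unit unitmx_tr.
Qed.

Lemma mcvg_chart (q : nat -> 'cV[C]_(pldim n)) p j :
  mcvg q p -> mcvg (fun k => chart j (q k)) (chart j p).
Proof.
move=> qp i a; rewrite mxE; apply: eq_scvg (mcvg_mul (mcvg_cst _) qp 0 0) => k.
by rewrite [chart _ _ _ _]mxE.
Qed.

Lemma mcvg_plrows (B : nat -> frame) E j :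
  mcvg B E -> mcvg (fun k => plrows (B k) j) (plrows E j).
Proof.
move=> BE b d; rewrite [plrows _ _ _ _]mxE.
by apply: eq_scvg (BE _ _) => k; rewrite [RHS]mxE.
Qed.

(** Closedness of the Grassmannian: both sides of [plucker_chart] are continuous, so the identity
    persists for [p], and [p j 0] then cancels. *)
Lemma plucker_chart_lim (c : nat -> C) (B : nat -> frame) p j :
  mcvg (fun k => c k *: plucker (B k)) p -> p j 0 != 0 ->
  plucker (chart j p) = p j 0 ^+ n *: p.
Proof.
move=> qp pj; apply: (scalerI pj); rewrite scalerA -exprS.
have pl : mcvg (fun k => plucker (chart j (c k *: plucker (B k)))) (plucker (chart j p)).
  move=> i a; rewrite (ord1 a) pluckerE.
  apply: eq_scvg (mcvg_det (mcvg_plrows i (mcvg_chart j qp))) => k.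
  by rewrite pluckerE.
apply: mcvg_uniq (mcvgZ (qp j 0) pl) _.
have powcvg m : scvg (fun k => (c k *: plucker (B k)) j 0 ^+ m) (p j 0 ^+ m).
  elim: m => [|m IH]; first exact: scvg_cst.
  by rewrite exprS; apply: eq_scvg (scvgM (qp j 0) IH) => k; rewrite exprS.
by apply: eq_mcvg (mcvgZ (powcvg n.+1) qp) => k; rewrite plucker_chart.
Qed.

Lemma plucker_neq0_rank B : plucker B != 0 -> \rank B = n.+1.
Proof. by rewrite plucker_neq0 => /eqP. Qed.

Lemma ext_pow_neq0 (A : 'M[C]_(n.*2.+2)) : A \in unitmx -> ext_pow A != 0.
Proof.
move=> Au; apply/eqP=> A0.
have : plucker (pid_mx n.+1 : frame) != 0.
  by rewrite plucker_neq0 rank_pid_mx // ltnS -addnn leqW // leq_addr.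
by rewrite -(mul1mx (plucker _)) -ext_pow1 -(mulVmx Au) ext_powM A0 mulmx0 mul0mx eqxx.
Qed.

Lemma mcvg_image (c : nat -> C) (s : nat -> 'M[C]_(n.*2.+2)) T B :
  mcvg (fun k => c k *: ext_pow (s k)) T ->
  mcvg (fun k => c k *: plucker (s k *m B)) (T *m plucker B).
Proof.
move=> cT; apply: eq_mcvg (mcvg_mul cT (mcvg_cst (plucker B))) => k.
by rewrite -scalemxAl plucker_mul.
Qed.

(** [T *m plucker B] is a limit of multiples of [plucker (s nu *m B)], so, being nonzero, it is
    proportional to the Pluecker vector of its chart. *)
Lemma limit_plane_image G s T B j : normal_seq G s ->
  normalized_cvg (fun nu => ext_pow (s nu)) T -> (T *m plucker B) j 0 != 0 ->
  limit_plane G (chart j (T *m plucker B)).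
Proof.
move=> ns nT pj; have [c [_ [_ /mx_cvgE cT]]] := nT.
have PE := plucker_chart_lim (mcvg_image B cT) pj.
split.
  apply: plucker_neq0_rank; rewrite PE scaler_eq0 expf_eq0 (negPf pj) andbF /=.
  by apply: contraNneq pj => ->; rewrite mxE.
exists s; split=> //; exists T; split=> //.
exists ((T *m plucker B) j 0 ^+ n *: plucker B).
by rewrite -scalemxAr PE.
Qed.

(* A plane in the image of T meeting the plane [B0] inside D would be a
   limit plane meeting D. *)
Lemma limit_map_rank_one G s T : typeL G -> normal_seq G s ->
  normalized_cvg (fun nu => ext_pow (s nu)) T ->
  exists (u : 'cV[C]_(pldim n)) lam, T = u *m lam.
Proof.
move=> [_ [_ [D [[_ [B0 [rB0 B0D]]] DO]]]] ns nT.
have [lam lamP] := meet_form rB0.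
have [|u uE] := @plucker_rank_one R n _ T (lam *m T); last by exists u, (lam *m T).
move=> B; rewrite -mulmxA => lamB; apply/eqP/negPn/negP=> /cV0Pn[j pj].
have lE := limit_plane_image ns nT pj.
have [c [_ [_ /mx_cvgE cT]]] := nT.
have PE := plucker_chart_lim (mcvg_image B cT) pj.
have [|v vE vB0] := lamP _ (proj1 lE).
  by rewrite PE -scalemxAr scalemx_entry lamB mulr0.
by have [_ []] := DO v (B0D v vB0); exists (chart j (T *m plucker B)).
Qed.

(** * Normal subsequences and invariance under the group *)

Lemma normal_subseq G s : pgl_subgroup G -> (forall nu, G (s nu)) ->
  (forall mu nu, mu <> nu -> ~ proportional (s mu) (s nu)) ->
  exists phi, (forall k, (phi k < phi k.+1)%N) /\ normal_seq G (s \o phi).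
Proof.
move=> [GU _] Gs sN.
have s0 k : s k != 0.
  apply/eqP=> sk; have := GU _ (Gs k).
  by rewrite sk unitmxE det0 unitr0.
(* Two successive extractions: for the matrices, then for their exterior powers. *)
have [phi [incr [S HS]]] := normalized_subseq s0.
have [|psi [incr' [T HT]]] := @normalized_subseq _ _ (fun k => ext_pow (s (phi k))).
  by move=> k; apply/ext_pow_neq0/GU/Gs.
have incr'' k : (phi (psi k) < phi (psi k.+1))%N by apply: (homo_ltn ltn_trans incr).
exists (phi \o psi); split=> //; split=> [nu|]; first exact: Gs.
split=> [mu nu mn|]; first by apply: sN => /(incr_inj incr'').
split; last by exists T.
by exists S; apply: (normalized_cvg_sub (incr_geq_id incr') HS).
Qed.

(** A subsequence of [g *m s nu] is normal, and its limit map is a nonzero multiple of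
    [ext_pow g *m T], whose image contains [plucker (g *m B)]. *)
Lemma limit_set_invariant G g v : pgl_subgroup G -> G g ->
  limit_set G v -> limit_set G (g *m v).
Proof.
move=> sG Gg [B [[rB [s [ns [T [nT [x Tx]]]]]] [v0 [y vy]]]].
have [GU [_ [_ [GM _]]]] := sG.
have gU := GU _ Gg; have [Gs [sN _]] := ns.
have [||phi [incr nphi]] := @normal_subseq G (fun nu => g *m s nu) sG.
- by move=> nu; apply: GM.
- move=> mu nu mn [c [c0 e]]; apply: (sN _ _ mn); exists c; split=> //.
  by rewrite -(mulKmx gU (s mu)) e -scalemxAr mulKmx.
have [_ [_ [_ [T' nT']]]] := nphi.
have [c [c0 [_ /mx_cvgE cT]]] := nT; have [c' [c'0 [_ /mx_cvgE cT']]] := nT'.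
have gT : mcvg (fun k => c (phi k) *: ext_pow (g *m s (phi k))) (ext_pow g *m T).
  have := mcvg_mul (mcvg_cst (ext_pow g)) (mcvg_sub (incr_geq_id incr) cT).
  by apply: eq_mcvg => k /=; rewrite -scalemxAr ext_powM.
have gT0 : ext_pow g *m T != 0.
  apply: contraNneq (normalized_cvg_neq0 nT) => e.
  by rewrite -(mulKmx (ext_pow_unit gU) T) e mulmx0.
have [d d0 T'E] := mcvg_proportional gT cT' gT0 (normalized_cvg_neq0 nT').
exists (g *m B); split.
  split; first by rewrite /nplane rank_mul_unit.
  exists ((fun nu => g *m s nu) \o phi); split=> //; exists T'; split=> //.
  exists (d^-1 *: x).
  rewrite T'E -scalemxAl -scalemxAr scalerA mulfV // scale1r -mulmxA Tx.
  by rewrite plucker_mul.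
split; last by exists y; rewrite -mulmxA vy.
by apply: contraNneq v0 => e; rewrite -(mulKmx gU v) e mulmx0.
Qed.

(** * Diagonal sequences and closedness *)

Lemma eventually_not_proportional (s : nat -> 'M[C]_(n.*2.+2)) (L : seq 'M[C]_(n.*2.+2)) :
  (forall mu nu, mu <> nu -> ~ proportional (s mu) (s nu)) ->
  exists N, forall nu, (N <= nu)%N -> forall h, h \in L -> ~ proportional h (s nu).
Proof.
move=> sN; elim: L => [|h L [N HN]]; first by exists 0.
(* At most one term of [s] is proportional to [h], so going past its index suffices. *)
have [[mu [c [c0 hmu]]]|nh] := pselect (exists mu, proportional h (s mu)).
  exists (maxn N mu.+1) => nu; rewrite geq_max => /andP[/HN HL munu] h'.
  rewrite inE => /orP[/eqP->|/HL//] [d [d0 hnu]].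
  apply: (sN mu nu) => [e|]; first by rewrite e ltnn in munu.
  exists (c^-1 * d); split; first by rewrite mulf_neq0 ?invr_eq0.
  by rewrite -scalerA -hnu hmu scalerA mulVf // scale1r.
exists N => nu /HN HL h'; rewrite inE => /orP[/eqP->|/HL//] hnu.
by apply: nh; exists nu.
Qed.

Lemma not_proportional_sequence (Q : nat -> 'M[C]_(n.*2.+2) -> Prop) :
  (forall k (L : seq 'M[C]_(n.*2.+2)), exists2 g, Q k g &
    forall h, h \in L -> ~ proportional h g) ->
  exists g, (forall k, Q k (g k)) /\
    forall mu nu, mu <> nu -> ~ proportional (g mu) (g nu).
Proof.
move=> H; have /choice[f fP] : forall kL : nat * seq 'M[C]_(n.*2.+2),
    exists g, Q kL.1 g /\ forall h, h \in kL.2 -> ~ proportional h g.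
  by move=> [k L]; have [g ? ?] := H k L; exists g.
(* [L k] lists the terms chosen before stage [k], which the next one must avoid. *)
pose L := fix L k := if k is k'.+1 then f (k', L k') :: L k' else [::].
pose g k := f (k, L k).
have gL mu nu : (mu < nu)%N -> g mu \in L nu.
  elim: nu => // nu IH; rewrite ltnS leq_eqVlt inE => /orP[/eqP->|/IH->].
    by rewrite eqxx.
  by rewrite orbT.
exists g; split=> [k|mu nu /eqP]; first by have [] := fP (k, L k).
rewrite neq_ltn => /orP[/gL|/gL] lt; first by have [_] := fP (nu, L nu); apply.
move=> [c [c0 e]]; have [_ /(_ _ lt)] := fP (mu, L mu); apply.
by exists c^-1; split; rewrite ?invr_eq0 // -/(g mu) e scalerA mulVf // scale1r.
Qed.

(* The image of a rank-one matrix is spanned by any of its nonzero vectors: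
   its columns are proportional to that vector. *)
Lemma rank_one_cross m p (u : 'cV[C]_m) (lam : 'rV[C]_p) (x : 'cV[C]_p) i j a :
  (u *m lam) i a * (u *m lam *m x) j 0 = (u *m lam) j a * (u *m lam *m x) i 0.
Proof.
rewrite -mulmxA [lam *m x]mx11_scalar mul_mx_scalar !scalemx_entry.
by rewrite !mxE !big_ord1; ring.
Qed.

Lemma limit_set_sequence_closed G (w : nat -> pt) v : typeL G ->
  (forall k, limit_set G (w k)) -> mcvg w v -> v != 0 -> limit_set G v.
Proof.
move=> LG Lw wv v0; have sG : pgl_subgroup G by case: LG.
(* Membership in an image need not survive limits, whereas the cross relation does. It says that the
   columns of [T] are multiples of [plucker B], which rank one provides. *)
pose approx k (g : 'M[C]_(n.*2.+2)) (d : C * 'M[C]_(pldim n) * frame) :=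
  let: (c, T, B) := d in
  [/\ c != 0, normalized (c *: ext_pow g),
      forall i j, `|(c *: ext_pow g) i j - T i j| < k.+1%:R^-1,
      forall i j a, T i a * plucker B j 0 = T j a * plucker B i 0 &
      \rank B = n.+1 /\ exists y, w k = B *m y].
have [|g [Gg gN]] := @not_proportional_sequence
    (fun k g => G g /\ exists d, approx k g d).
  move=> k L; have [B [[rB [s [ns [T [nT [x Tx]]]]]] [_ [y wy]]]] := Lw k.
  have [Gs [sN _]] := ns.
  have [u [lam TE]] := limit_map_rank_one LG ns nT.
  have [c [c0 [nc cT]]] := nT.
  have [N HN] := eventually_not_proportional L sN.
  have [|M HM] := cT (k.+1%:R^-1); first by rewrite invr_gt0 ltr0n.
  exists (s (maxn N M)); last by apply: HN; apply: leq_maxl.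
  split; first exact: Gs.
  exists (c (maxn N M), T, B); split=> //; last by split=> //; exists y.
    move=> i j; have := HM _ (leq_maxr N M) i j.
    by rewrite fmorphV rmorph_nat.
  by move=> i j a; rewrite -Tx TE rank_one_cross.
have /choice[d dP] k := proj2 (Gg k).
pose c k := (d k).1.1; pose T k := (d k).1.2; pose B k := (d k).2.
have {}dP k : [/\ c k != 0, normalized (c k *: ext_pow (g k)),
      forall i j, `|(c k *: ext_pow (g k)) i j - T k i j| < k.+1%:R^-1,
      forall i j a, T k i a * plucker (B k) j 0 = T k j a * plucker (B k) i 0 &
      \rank (B k) = n.+1 /\ exists y, w k = B k *m y].
  by have := dP k; rewrite /c /T /B; case: (d k) => [[? ?] ?] [].
have /choice[e eP] k : exists e, e != 0 /\ normalized (e *: plucker (B k)).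
  have [|e e0 ne] := @normalized_scale R _ _ (plucker (B k)); last by exists e.
  by have [_ _ _ _ [rB _]] := dP k; rewrite plucker_neq0 rB.
(* Three nested extractions: convergence of the normalized exterior powers, of the normalized
   Pluecker vectors, then normality. *)
have [|phi1 [incr1 [S HS]]] := @bw_mx R _ _ (fun k => c k *: ext_pow (g k)).
  by move=> k; have [_ [? _]] := dP k.
have [|phi2 [incr2 [p Hp]]] := @bw_mx R _ _ (fun k => e (phi1 k) *: plucker (B (phi1 k))).
  by move=> k; have [_ [? _]] := eP (phi1 k).
have incr12 k : (phi1 (phi2 k) < phi1 (phi2 k.+1))%N by apply: (homo_ltn ltn_trans incr1).
have [||phi3 [incr3 nphi]] := @normal_subseq G (g \o (phi1 \o phi2)) sG.
- by move=> k; have [] := Gg (phi1 (phi2 k)).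
- by move=> mu nu mn; apply: gN => /(incr_inj incr12).
pose psi k := phi1 (phi2 (phi3 k)).
have psik k : (k <= psi k)%N.
  apply: (leq_trans (incr_geq_id incr3 k)).
  exact: (incr_geq_id incr12).
have {}HS : mcvg (fun k => c (psi k) *: ext_pow (g (psi k))) S.
  have /(mcvg_sub (incr_geq_id incr3)) := mcvg_sub (incr_geq_id incr2) HS.
  exact.
have {}Hp : mcvg (fun k => e (psi k) *: plucker (B (psi k))) p.
  exact: (mcvg_sub (incr_geq_id incr3) Hp).
have nS : normalized_cvg (fun k => ext_pow (g (psi k))) S.
  exists (c \o psi); split=> [k|]; first by have [] := dP (psi k).
  by split=> [k|]; [have [] := dP (psi k)|apply/mx_cvgE].
have TS : mcvg (fun k => T (psi k)) S.
  move=> i j; apply: (scvg_near (scvg_sub psik (@inv_succ_cvg0 R)) _ (HS i j)) => k.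
  by have [_ _ H _ _] := dP (psi k); rewrite distrC; apply: H.
have cross i j a : S i a * p j 0 = S j a * p i 0.
  apply: (scvg_uniq (scvgM (TS i a) (Hp j 0))).
  apply: eq_scvg (scvgM (TS j a) (Hp i 0)) => k.
  have [_ _ _ H _] := dP (psi k).
  by rewrite !scalemx_entry mulrCA -H mulrCA.
have p0 : p != 0 by apply: normalized_lim_neq0 Hp => k; have [] := eP (psi k).
have /cV0Pn[j pj] := p0.
have PE := plucker_chart_lim Hp pj.
have /matrix0Pn[i [a Sia]] := normalized_cvg_neq0 nS.
(* The cross relation makes column [a] of [S] a multiple of [p], so it is nonzero in row [j] like
   [p]. *)
have Sja : S j a != 0.
  apply: contraNneq (mulf_neq0 Sia pj) => Sja.
  by rewrite cross Sja mul0r.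
exists (chart j p); split.
  split.
    apply: plucker_neq0_rank; rewrite PE scaler_eq0 expf_eq0 (negPf pj) andbF.
    exact: p0.
  exists ((g \o (phi1 \o phi2)) \o phi3); split=> //.
  (* Column [a] of [S] is [S j a / p j 0] times [p], while the target is [p j 0 ^+ n *: p]. *)
  exists S; split=> //; exists ((p j 0 ^+ n.+1 / S j a) *: delta_mx a 0).
  rewrite PE -scalemxAr -colE; apply/colP=> l.
  rewrite !scalemx_entry mxE; apply: (mulfI Sja).
  transitivity (p j 0 ^+ n * (S l a * p j 0)); first by rewrite exprS; field.
  by rewrite cross mulrCA.
split=> //.
(* The coordinates in the rows [plset j] converge with the points; [chart_incidence] in the limit
   puts [v] on the limit plane. *)
pose rw (v : pt) : 'cV[C]_n.+1 := \col_b v (rows_of (plset j) b) 0.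
have rwcvg : mcvg (fun k => rw (w (psi k))) (rw v).
  move=> b l; rewrite mxE (ord1 l).
  by apply: eq_scvg (scvg_sub psik (wv _ 0)) => k; rewrite mxE.
have inc : chart j p *m rw v = p j 0 *: v.
  apply: mcvg_uniq (mcvg_mul (mcvg_chart j Hp) rwcvg) _.
  apply: eq_mcvg (mcvgZ (Hp j 0) (mcvg_sub psik wv)) => k /=.
  have [_ _ _ _ [_ [y wy]]] := dP (psi k).
  have -> : rw (w (psi k)) = plrows (B (psi k)) j *m y.
    apply/colP=> b; rewrite wy !mxE; apply: eq_bigr => l _.
    by rewrite mxE.
  rewrite chartZ -scalemxAl chart_incidence scalemx_entry wy.
  by rewrite scalerA.
exists ((p j 0)^-1 *: rw v).
by rewrite -scalemxAr inc scalerA mulVf // scale1r.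
Qed.

Lemma limit_set_scale G c v : c != 0 -> limit_set G v -> limit_set G (c *: v).
Proof.
move=> c0 [B [lB [v0 [x vx]]]]; exists B; split=> //; split.
  by rewrite scaler_eq0 negb_or c0.
by exists (c *: x); rewrite -scalemxAr vx.
Qed.

Lemma limit_set_closed G : typeL G -> pclosed (limit_set G).
Proof.
move=> LG; have L0 v : limit_set G v -> v != 0 by case=> B [_ []].
split; first by move=> v c Lv c0; split; [apply: L0|apply: limit_set_scale].
split=> [v c [v0 nv] c0|v [v0 nv]].
  split=> //; split=> [|Lv]; first by rewrite scaler_eq0 negb_or c0.
  apply: nv; rewrite -(scale1r v) -(mulVf c0) -scalerA.
  by apply: limit_set_scale; rewrite ?invr_eq0.
apply: contrapT => nU.
have /choice[w wP] k : exists w, limit_set G w /\ mx_near w v k.+1%:R^-1.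
  apply: contrapT => nw; apply: nU; exists k.+1%:R^-1.
  split; first by rewrite invr_gt0 ltr0n.
  by move=> w w0 wv; split=> // Lw; apply: nw; exists w.
apply: nv; apply: (limit_set_sequence_closed LG (w := w)) => // [k|].
  by have [] := wP k.
by apply: mx_near_cvg => k; have [] := wP k.
Qed.

(** * Nowhere density *)

Lemma popen_eventually m (U : 'cV[C]_m -> Prop) (w : nat -> 'cV[C]_m) (v : 'cV[C]_m) :
  popen U -> U v -> mcvg w v -> exists N, forall k, (N <= k)%N -> U (w k).
Proof.
move=> [pU oU] Uv wv; have [v0 _] := pU _ _ Uv (oner_neq0 _).
have [e [e0 eU]] := oU _ Uv; have /mx_cvgE/(_ e e0) [N HN] := wv.
(* Openness only concerns nonzero vectors, so [w k] must also be nonzero eventually. *)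
have /cV0Pn[i vi] := v0; have [M HM] := scvg_neq0 (wv i 0) vi.
exists (maxn N M) => k; rewrite geq_max => /andP[Nk Mk]; apply: eU; last exact: HN.
by apply: contraNneq (HM k Mk) => ->; rewrite mxE.
Qed.

(** By compactness: points outside [D] on infinitely many planes have normalized parameters with a
    limit [y], nonzero, and [B *m y] lies in the open set [D]. *)
Lemma nearby_planes (D : pt -> Prop) (Bk : nat -> frame) B : popen D ->
  \rank B = n.+1 -> (forall v, plane_pts B v -> D v) -> mcvg Bk B ->
  exists N, forall k, (N <= k)%N -> forall v, plane_pts (Bk k) v -> D v.
Proof.
move=> oD rB BD BkB; apply: contrapT => nN.
have [phi [incr Hphi]] : exists phi : nat -> nat, (forall k, (phi k < phi k.+1)%N) /\
    forall k, exists v, plane_pts (Bk (phi k)) v /\ ~ D v.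
  apply: (@subseq_choice (fun _ k => exists v, plane_pts (Bk k) v /\ ~ D v)) => _ N.
  apply: contrapT => nk; apply: nN; exists N => k Nk v vk.
  by apply: contrapT => nD; apply: nk; exists k => //; exists v.
have /choice[x xP] k : exists x : 'cV[C]_n.+1, normalized x /\ ~ D (Bk (phi k) *m x).
  have [v [[v0 [x vx]] nD]] := Hphi k.
  have x0 : x != 0 by apply: contraNneq v0 => x0; rewrite vx x0 mulmx0.
  have [c c0 nc] := normalized_scale x0; exists (c *: x); split=> // Dcx; apply: nD.
  have [_] := oD.1 _ c^-1 Dcx (invr_neq0 c0).
  by rewrite -scalemxAr scalerA mulVf // scale1r -vx.
have [|psi [incr' [y Hy]]] := @bw_mx R _ _ x; first by move=> k; have [[]] := xP k.
have y0 : y != 0 by apply: normalized_lim_neq0 Hy => k; have [] := xP (psi k).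
have cv := mcvg_mul (mcvg_sub (incr_geq_id incr') (mcvg_sub (incr_geq_id incr) BkB)) Hy.
have [|N /(_ N (leqnn N))] := popen_eventually oD _ cv.
  by apply: BD; split; [apply: frame_mul_neq0|exists y].
by have [_] := xP (psi N); apply.
Qed.

(* A vector [T *m plucker _] nonzero somewhere is a nonzero polynomial on a line
   through [B]. *)
Lemma generic_nearby_plane (D : pt -> Prop) B (T : 'M[C]_(pldim n)) : popen D ->
  \rank B = n.+1 -> (forall v, plane_pts B v -> D v) -> T != 0 ->
  exists2 B', (forall v, plane_pts B' v -> D v) & T *m plucker B' != 0.
Proof.
move=> oD rB BD T0.
have [B1 [i B1i]] : exists B1 i, (T *m plucker B1) i 0 != 0.
  apply: contrapT => H; move/negP: T0; apply; apply/eqP/eq_on_plucker => B1.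
  rewrite mul0mx; apply/colP=> i; rewrite [RHS]mxE; apply/eqP/negPn/negP=> nz.
  by apply: H; exists B1, i.
have rowE A : (row i T *m plucker A) 0 0 = (T *m plucker A) i 0.
  by rewrite -row_mul mxE.
have [q qE] := plucker_line_poly (row i T) B (B1 - B).
have q0 : q != 0.
  apply: contraNneq B1i => q0; have := qE 1.
  by rewrite scale1r addrC subrK rowE q0 horner0 => ->.
have Bcvg : mcvg (fun k => B + k.+1%:R^-1 *: (B1 - B)) B.
  have := mcvgD (mcvg_cst B) (mcvgZ (@inv_succ_cvg0 R) (mcvg_cst (B1 - B))).
  by rewrite scale0r addr0.
have [N HN] := nearby_planes oD rB BD Bcvg.
have invI : injective (fun k => k.+1%:R^-1 : C).
  by move=> k l /invr_inj/eqP; rewrite eqr_nat => /eqP[].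
have [k Nk qk] := poly_nonroot N q0 invI.
exists (B + k.+1%:R^-1 *: (B1 - B)); first exact: HN.
by apply: contraNneq qk => TP; rewrite -qE rowE TP mxE.
Qed.

(** As the limit set is closed, [U] lies inside it. Points of the planes [s nu *m B'] tend to [v],
    so one of them is in [U]; pulled back by [s nu], it stays in the limit set by invariance, yet
    lies on [B'], inside [D]. *)
Lemma limit_set_nowhere_dense G : typeL G -> pnowhere_dense (limit_set G).
Proof.
move=> LG U oU Ucl v Uv; have sG : pgl_subgroup G by case: LG.
have UL w : U w -> limit_set G w.
  move=> Uw; have [w0 clw] := Ucl _ Uw; apply: contrapT => nLw.
  have [_ oC] := limit_set_closed LG.
  by have [|x [[_ nLx] /nLx]] := clw _ oC.
have [B [[rB [s [ns [T [nT [x Tx]]]]]] [v0 [y vy]]]] := UL _ Uv.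
have [_ [_ [D [[[oD _] [B0 [rB0 B0D]]] DO]]]] := LG.
have [B' B'D TB'] := generic_nearby_plane oD rB0 B0D (normalized_cvg_neq0 nT).
have [u [lam TE]] := limit_map_rank_one LG ns nT.
(* Both vectors are nonzero and in the image of [T], which is the line spanned by [u]. *)
have [al al0 PE] : exists2 al, al != 0 & plucker B = al *: (T *m plucker B').
  have imT z : T *m z = (lam *m z) 0 0 *: u.
    by rewrite TE -mulmxA {1}[lam *m z]mx11_scalar mul_mx_scalar.
  have PB0 : plucker B != 0 by rewrite plucker_neq0 rB.
  move: TB' PB0; rewrite -Tx !imT !scaler_eq0 !negb_or => /andP[b0 _] /andP[a0 _].
  exists ((lam *m x) 0 0 / (lam *m plucker B') 0 0); first by rewrite mulf_neq0 ?invr_eq0.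
  by rewrite scalerA divfK.
have [c [_ [_ /mx_cvgE cT]]] := nT.
have cvP : mcvg (fun nu => al *: (c nu *: plucker (s nu *m B'))) (plucker B).
  by rewrite PE; apply: mcvgZ (scvg_cst al) (mcvg_image B' cT).
have /cV0Pn[j Pj] : plucker B != 0 by rewrite plucker_neq0 rB.
(* The parameter of [v] in the chart of the limit plane; used unchanged in the charts of the moving
   planes, it yields points tending to [v]. *)
pose z := (plucker B j 0)^-1 *: (plrows B j *m y).
have vz : chart j (plucker B) *m z = v.
  by rewrite -scalemxAr chart_incidence scalerA mulVf // scale1r.
have cvw := mcvg_mul (mcvg_chart j cvP) (mcvg_cst z); rewrite vz in cvw.
have [N /(_ N (leqnn N)) UN] := popen_eventually oU Uv cvw.
have [GU [_ [_ [_ GV]]]] := sG; have [Gs _] := ns.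
have := limit_set_invariant sG (GV _ (Gs N)) (UL _ UN).
set w' := invmx _ *m _ => Lw'.
have w'0 : w' != 0 by case: Lw' => E [_ []].
suff Dw' : D w' by have [_ []] := DO w' Dw'.
apply: B'D; split=> //.
(* By [chart_plucker] the chart frame is [s N *m B'] times a square matrix, so [invmx (s N)] leaves
   a point of [B']. *)
exists (al *: (c N *: (\adj (plrows (s N *m B') j) *m z))).
rewrite /w' !chartZ chart_plucker -!scalemxAl -!scalemxAr.
by rewrite !mulmxA mulVmx ?mul1mx //; apply: GU.
Qed.

End LimitSet.

Theorem theorem4p10 (R : realType) (n : nat) (G : 'M[R[i]]_(n.*2.+2) -> Prop) :
  (0 < n)%N -> typeL G ->
  pclosed (limit_set G) /\ pnowhere_dense (limit_set G) /\
  (forall g v, G g -> limit_set G v -> limit_set G (g *m v)).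
Proof.
move=> _ LG; split; first exact: limit_set_closed.
split; first exact: limit_set_nowhere_dense.
by move=> g v; apply: limit_set_invariant; case: LG.
Qed.
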